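(* Every plane Laman graph admits an extended weak labeling.
   Context: A Laman graph is a graph with $n$ vertices and $2n-3$ edges such that every induced subgraph on $k\ge 2$ vertices has at most $2k-3$ edges; a plane Laman graph is a Laman graph with a fixed planar embedding. An angle is an incidence of a vertex with a face. An extended weak labeling of a plane Laman graph $G$ is a map from its angles to $\{0,1\}$ such that: (G$0'$) there are two adjacent special vertices $s_0,s_1$ such that all angles at $s_i$ are labeled $i$; (G1) for each vertex $v\notin\{s_0,s_1\}$ the labels around $v$ form one non-empty cyclic interval of $1$s and one non-empty cyclic interval of $0$s; (G$2'$) for each edge other than $s_0s_1$, the two labels on the two sides of the edge coincide at one endpoint and differ at the other; (G3) for each face (including the outer face), its labels, read cyclically, form one non-empty interval of $1$s and one non-empty interval of $0$s. *)

(* Defs.v *)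
(* Plane graphs are encoded combinatorially by rotation systems. *)
From HB Require Import structures.
From mathcomp Require Import all_boot fingroup perm.
Set Implicit Arguments. Unset Strict Implicit. Unset Printing Implicit Defensive.

Section Defs.
Variable V : finType.

Definition simple_graph (e : rel V) := symmetric e /\ irreflexive e.

Definition edges (e : rel V) : {set {set V}} :=
  [set [set p.1; p.2] | p : V * V & e p.1 p.2].

Definition induced_edges (e : rel V) (S : {set V}) : {set {set V}} :=
  [set [set p.1; p.2] | p : V * V & [&& p.1 \in S, p.2 \in S & e p.1 p.2]].

(* Laman: n vertices, 2n-3 edges (stated as |E| + 3 = 2n, which forces n >= 2),
   every induced subgraph on k >= 2 vertices has at most 2k-3 edges *)
Definition laman (e : rel V) :=
  #|edges e| + 3 = 2 * #|V| /\
  forall S : {set V}, 2 <= #|S| -> #|induced_edges e S| + 3 <= 2 * #|S|.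

Definition dart (e : rel V) := {p : V * V | e p.1 p.2}.
Definition tail (e : rel V) (d : dart e) : V := (val d).1.
Definition head (e : rel V) (d : dart e) : V := (val d).2.
(* reversal of a dart (well defined for a symmetric relation) *)
Definition rev_dart (e : rel V) (d : dart e) : dart e :=
  insubd d ((val d).2, (val d).1).

Definition rotation_system (e : rel V) (sigma : {perm dart e}) :=
  (forall d, tail (sigma d) = tail d) /\
  (forall d d', tail d = tail d' -> fconnect sigma d d').

(* face permutation: after traversing d, continue with the dart following
   (rev d) in the rotation at the head of d *)
Definition face_succ (e : rel V) (sigma : {perm dart e}) (d : dart e) : dart e :=
  sigma (rev_dart d).

(* a planar (spherical) embedding of a connected graph: a rotation system
   of genus 0, i.e. satisfying Euler's formula  V - E + F = 2 *)
Definition plane_embedding (e : rel V) (sigma : {perm dart e}) :=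
  rotation_system sigma /\
  (forall u v : V, connect e u v) /\
  #|V| + fcard (face_succ sigma) (@predT (dart e)) = #|edges e| + 2.

(* Angles.  The angle (corner) indexed by the dart x is the corner at tail x
   between the darts sigma^-1 x and x; it lies in the face whose boundary walk
   contains x.  So angles at v in cyclic order = sigma-orbit, angles of a face
   in cyclic order = face_succ-orbit.  Label 1 = true, 0 = false. *)

Definition one_interval_each (s : seq bool) :=
  exists k a b, 0 < a /\ 0 < b /\ rot k s = nseq a true ++ nseq b false.

Definition ext_weak_labeling (e : rel V) (sigma : {perm dart e})
    (s0 s1 : V) (lam : dart e -> bool) :=
  (e s0 s1 /\ forall d : dart e,
      (tail d = s0 -> lam d = false) /\ (tail d = s1 -> lam d = true)) /\
  (forall d : dart e, tail d <> s0 -> tail d <> s1 ->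
      one_interval_each (map lam (fingraph.orbit sigma d))) /\
  (* G2': the two sides of edge d are the corners d, sigma d at tail d
     and the corners rev d, sigma (rev d) at head d *)
  (forall d : dart e, [set tail d; head d] != [set s0; s1] ->
      (lam d == lam (sigma d)) != (lam (rev_dart d) == lam (sigma (rev_dart d)))) /\
  (forall d : dart e, one_interval_each (map lam (fingraph.orbit (face_succ sigma) d))).

End Defs.

(* Main.v *)
(** Orient the edges of the Laman graph so that [s1] has out-degree 0, [s0] has
    only the out-edge [s0 s1] and every other vertex has out-degree 2 (Hakimi's
    theorem; the Laman count is exactly the required sparsity).  Let the labels
    around a vertex [v] change precisely at its out-edges: this fixes them up to
    one bit per vertex, and (G0'), (G1), (G2') hold for every choice of the bits.

    By (G2') every edge other than [s0 s1] contributes one label change to one of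
    its two faces, and [s0 s1] contributes one to both, so that the faces see
    [|E| + 1 = 2n - 2] changes in total.  By Euler's formula this is twice the
    number of faces, hence (G3) only asks for bits making no face constant.

    Such bits exist by a sign argument.  For a set of faces not incident to
    [s0 s1] whose boundary graph is connected, independence of the face boundaries
    in the cycle space and the Laman count on the boundary vertices show that there
    are more non-special boundary vertices than faces.  So some non-zero vector [y]
    on these vertices satisfies, for each face, that the sum of [+- y v] over its
    angles vanishes; choosing the bits on the support of [y] by sign gives both
    labels to every face meeting the support, and the other faces are treated
    recursively. *)
From mathcomp Require Import all_boot all_order all_algebra fingroup perm.
From mathcomp Require Import zify.
Require Import Defs.
Set Implicit Arguments. Unset Strict Implicit. Unset Printing Implicit Defensive.
Import Order.TTheory GRing.Theory Num.Theory.

(** * Linear algebra over the rationals *)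

Section LinearSystem.
Local Open Scope ring_scope.

(** The rank is at most the number of equations, so the kernel is non-zero; a kernel vector is
    extended by zero off [B]. *)
Lemma underdetermined_system (I J : finType) (A : {set I}) (B : {set J})
    (M : I -> J -> rat) :
  (#|A| < #|B|)%N ->
  exists y : J -> rat,
    [/\ exists2 j, j \in B & y j != 0,
        forall j, j \notin B -> y j = 0 &
        forall i, i \in A -> \sum_j M i j * y j = 0].
Proof.
move=> ltAB.
pose N := \matrix_(j < #|B|, i < #|A|) M (enum_val i) (enum_val j).
have kerN0 : kermx N != 0.
  rewrite -mxrank_eq0 mxrank_ker -lt0n subn_gt0.
  exact: leq_ltn_trans (rank_leq_col N) ltAB.
have [u uN u0] : exists2 u : 'rV_#|B|, u *m N = 0 & u != 0.
  exists (nz_row (kermx N)); last by rewrite nz_row_eq0.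
  by apply/sub_kermxP; exact: nz_row_sub.
pose y j := \sum_(k < #|B|) u 0 k *+ (enum_val k == j).
have yE k : y (enum_val k) = u 0 k.
  rewrite /y (bigD1 k) //= eqxx big1 ?addr0 // => l lk.
  by rewrite (inj_eq enum_val_inj) (negbTE lk).
exists y; split.
- have [k uk] : exists k, u 0 k != 0.
    apply/existsP; apply: contraNT u0; rewrite negb_exists => /forallP z.
    by apply/eqP/rowP => k; rewrite mxE; apply/eqP; have := z k; rewrite negbK.
  by exists (enum_val k); [exact: enum_valP | rewrite yE].
- move=> j jB; rewrite /y big1 // => k _.
  by case: eqP => // kj; rewrite -kj enum_valP in jB.
move=> i iA.
have /rowP/(_ (enum_rank_in iA i)) := uN; rewrite !mxE; apply: etrans.
under eq_bigr do rewrite /y mulr_sumr.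
rewrite exchange_big /=; apply: eq_bigr => k _.
rewrite mxE enum_rankK_in // (bigD1 (enum_val k)) //= eqxx mulr1n.
by rewrite big1 ?addr0 1?mulrC // => j kj; rewrite eq_sym (negbTE kj) mulr0.
Qed.

(** Without a positive term, the [- F i] are non-negative with sum 0, hence all zero; negating [F]
    gives the other sign. *)
Lemma sum0_opposite_signs (I : finType) (P : pred I) (F : I -> rat) i0 :
  P i0 -> F i0 != 0 -> \sum_(i | P i) F i = 0 ->
  (exists2 i, P i & 0 < F i) /\ (exists2 i, P i & F i < 0).
Proof.
have pos (G : I -> rat) : P i0 -> G i0 != 0 -> \sum_(i | P i) G i = 0 ->
    exists2 i, P i & 0 < G i.
  move=> Pi0 Gi0 sG; apply/exists_inP; apply: contraNT Gi0.
  rewrite negb_exists_in => /forall_inP np.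
  have /eqP : \sum_(i | P i) (- G i) = 0 by rewrite sumrN sG oppr0.
  rewrite psumr_eq0 => [/allP/(_ i0)|i Pi]; last by rewrite oppr_ge0 leNgt np.
  by rewrite mem_index_enum Pi0 oppr_eq0 => /(_ isT).
move=> Pi0 Fi0 sF; split; first exact: pos.
have [] := pos (fun i => - F i) Pi0; rewrite ?oppr_eq0 ?sumrN ?sF ?oppr0 //.
by move=> i Pi; rewrite oppr_gt0; exists i.
Qed.

End LinearSystem.

(** * Label changes along the cycles of a permutation *)

Section CyclicIntervals.
Variables (T : finType) (f : T -> T) (lam : T -> bool).
Hypothesis injf : injective f.

Let chg x := lam x != lam (f x).

Lemma traject_const n z : lam z = false -> count chg (traject f z n) = 0 ->
  map lam (traject f z n.+1) = nseq n.+1 false.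
Proof.
elim: n z => [|n IH] z lz /=; first by rewrite lz.
rewrite {1}/chg lz => /eqP; rewrite addn_eq0 => /andP[/eqP c1 /eqP c2].
have lfz : lam (f z) = false by case: (lam (f z)) c1.
by have /= := IH _ lfz c2 => ->.
Qed.

Lemma traject_drop n z : lam z = true -> lam (iter n f z) = false ->
  0 < count chg (traject f z n) /\
  (count chg (traject f z n) <= 1 ->
   exists a b, [/\ 0 < a, 0 < b &
     map lam (traject f z n.+1) = nseq a true ++ nseq b false]).
Proof.
elim: n z => [|n IH] z lz; first by rewrite /= lz.
rewrite iterSr => lz'; rewrite [traject f z n.+1]/= [count _ _]/= {1 3}/chg lz.
case lfz : (lam (f z)) => /=.
  have [c1 c2] := IH _ lfz lz'; rewrite add0n; split=> // /c2[a [b [a0 b0 E]]].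
  by exists a.+1, b; split=> //=; move: E => /= ->; rewrite lz.
split=> // c1.
have /(traject_const lfz) E : count chg (traject f (f z) n) = 0 by lia.
by exists 1, n.+1; split=> //; move: E => /= ->; rewrite lz.
Qed.

(** Cut the cycle right after a change from 0 to 1: the remaining walk goes from 1 to 0, so it
    contains a second change, and without a third it is one block of each label. *)
Lemma orbit_changes d a b :
  fconnect f d a -> fconnect f d b -> lam a != lam b ->
  2 <= #|[pred x | fconnect f d x & chg x]| /\
  (#|[pred x | fconnect f d x & chg x]| <= 2 ->
   one_interval_each (map lam (fingraph.orbit f d))).
Proof.
move=> da db ab.
wlog [la lb] : a b da db ab / lam a = false /\ lam b = true.
  case la : (lam a) ab; case lb : (lam b) => // _ W.
    by apply: (W b a) => //; rewrite la lb.
  by apply: (W a b) => //; rewrite la lb.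
(* Without such a step the label 0 would propagate along the orbit from [a] to [b]. *)
have [z dz [lz lfz]] : exists2 z, fconnect f d z & lam z = false /\ lam (f z).
  case: (pickP [pred z | [&& fconnect f d z, ~~ lam z & lam (f z)]]) => [z|no].
    by case/and3P=> dz /negbTE lz lfz; exists z.
  have ab' : fconnect f a b.
    by rewrite (same_connect (fconnect_sym injf) (_ : fconnect f a d)) // fconnect_sym.
  have/iter_findex := ab'.
  suff H n : lam (iter n f a) = false by move=> E; rewrite -E H in lb.
  elim: n => //= n IH; have := no (iter n f a); rewrite /= IH /=.
  by rewrite (connect_trans da (fconnect_iter _ _ _)).
have dfz : fconnect f d (f z) by rewrite -same_fconnect1_r.
have E : #|[pred x | fconnect f d x & chg x]|
         = count chg (fingraph.orbit f (f z)).
  rewrite -size_filter -(card_uniqP _) ?filter_uniq ?orbit_uniq //.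
  apply: eq_card => x; rewrite !inE mem_filter -fconnect_orbit andbC.
  by congr andb; apply: (same_connect (fconnect_sym injf)).
have ford : iter (fingraph.order f (f z)).-1 f (f z) = z.
  exact: (finv_f injf).
have := @traject_drop (fingraph.order f (f z)).-1 (f z) lfz; rewrite ford => /(_ lz).
have {}E : #|[pred x | fconnect f d x & chg x]|
    = (count chg (traject f (f z) (fingraph.order f (f z)).-1)).+1.
  rewrite E /fingraph.orbit -{1}orderSpred trajectSr -cats1 count_cat ford.
  by rewrite /= {2}/chg lz lfz /= addn1.
rewrite {}E !ltnS.
move=> [c1 c2]; split=> // /c2[m [n [m0 n0 H]]].
have [k kE] := orbit_rot_cycle (cycle_orbit injf d) (orbit_uniq f d)
  (etrans (esym (fconnect_orbit f d (f z))) dfz).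
exists k, m, n; do 2!split => //.
by rewrite -map_rot -kE -H orderSpred.
Qed.

(** [r d] is the parity of the number of points of [D] from the root of the orbit up to [d],
    exclusive; evenness makes it consistent once round the cycle. The second clause later gives
    constant labels at the special vertices. *)
Lemma cyclic_primitive (D : pred T) :
  (forall d, ~~ odd #|[pred x | fconnect f d x & D x]|) ->
  exists r : T -> bool, (forall d, r (f d) = r d (+) D d) /\
    (forall d, (forall x, fconnect f d x -> ~~ D x) -> r d = false).
Proof.
move=> evD.
pose rt := froot f.
pose r d := odd (count D (traject f (rt d) (findex f (rt d) d))).
have cr d : fconnect f (rt d) d by rewrite fconnect_sym // connect_root.
have rtf d : rt (f d) = rt d.
  rewrite /rt; apply/(fingraph.rootP (fconnect_sym injf)).
  by rewrite fconnect_sym // fconnect1.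
exists r; split=> d; last first.
  move=> nD; rewrite /r (_ : count _ _ = 0) //; apply/eqP.
  rewrite -leqn0 leqNgt -has_count; apply/hasPn => x /trajectP[i _ ->].
  by apply: nD; apply: connect_trans (connect_root _ d) (fconnect_iter _ _ _).
rewrite /r rtf; set z := rt d; have dE := iter_findex (cr d).
have := findex_max (cr d); rewrite -/z -/(rt d) -/z.
have := dE; rewrite -/z; set i := findex f z d => {}dE lti.
have step : odd (count D (traject f z i.+1)) = odd (count D (traject f z i)) (+) D d.
  by rewrite trajectSr -cats1 count_cat /= dE addn0 oddD; case: (D d).
have [lt|ge] := ltnP i.+1 (fingraph.order f z).
  by rewrite -dE -iterS findex_iter // step dE.
(* Here [f d] is the root again, where the count restarts at 0. *)
have iE : i.+1 = fingraph.order f z by apply/eqP; rewrite eqn_leq lti ge.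
rewrite -step -dE -iterS iE iter_order // findex0 /=; symmetry; apply/negbTE.
have := evD z; congr (~~ odd _).
rewrite -size_filter -(card_uniqP _) ?filter_uniq ?orbit_uniq //.
by apply: eq_card => x; rewrite !inE mem_filter -fconnect_orbit andbC.
Qed.

End CyclicIntervals.

(** * Darts and orientations *)

Section Darts.
Variables (V : finType) (e : rel V).
Hypothesis sg : simple_graph e.

Lemma tail_rev (d : dart e) : tail (rev_dart d) = head d.
Proof.
have [es _] := sg; rewrite /tail /rev_dart val_insubd /=.
by rewrite es (valP d).
Qed.

Lemma head_rev (d : dart e) : head (rev_dart d) = tail d.
Proof.
have [es _] := sg; rewrite /head /rev_dart val_insubd /=.
by rewrite es (valP d).
Qed.

Lemma dart_inj (d d' : dart e) : tail d = tail d' -> head d = head d' -> d = d'.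
Proof.
rewrite /tail /head => ht hh; apply: val_inj.
by rewrite [LHS]surjective_pairing ht hh -surjective_pairing.
Qed.

Lemma rev_dartK : involutive (@rev_dart V e).
Proof. by move=> d; apply: dart_inj; rewrite !(tail_rev, head_rev). Qed.

Lemma tail_neq_head (d : dart e) : tail d != head d.
Proof.
have [_ ir] := sg; apply: contraTneq (valP d).
by rewrite /tail /head => ->; rewrite ir.
Qed.

Lemma rev_dart_neq (d : dart e) : rev_dart d != d.
Proof.
by apply: contraNneq (tail_neq_head d) => E; rewrite -tail_rev E.
Qed.

Lemma dartP u v : e u v -> exists d : dart e, tail d = u /\ head d = v.
Proof. by move=> uv; exists (Sub (u, v) uv). Qed.

Definition orientation (o : dart e -> bool) := forall d, o (rev_dart d) = ~~ o d.

Definition outdeg (o : dart e -> bool) v := #|[pred d | o d & tail d == v]|.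

(** Exactly one of the two darts of each edge is oriented, so taking the pair of ends is a
    bijection. *)
Lemma card_oriented_darts o (R : {set V}) : orientation o ->
  #|[pred d | [&& o d, tail d \in R & head d \in R]]| = #|induced_edges e R|.
Proof.
move=> oo; pose en (d : dart e) : {set V} := [set tail d; head d].
rewrite -(@card_in_imset _ _ en).
  apply: eq_card => E; apply/imsetP/imsetP.
    move=> [d]; rewrite inE => /and3P[od td hd] ->; exists (val d) => //.
    by rewrite inE td hd (valP d).
  case=> -[u v]; rewrite inE /= => /and3P[uR vR uv] ->.
  have [d [td hd]] := dartP uv.
  have [od|nod] := boolP (o d).
    by exists d; rewrite ?inE ?od /en td hd ?uR ?vR.
  by exists (rev_dart d); rewrite ?inE /en ?oo tail_rev head_rev td hd;
    rewrite ?nod ?uR ?vR // setUC.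
move=> d d'; rewrite !inE => /and3P[od _ _] /and3P[od' _ _] E.
have := set21 (tail d) (head d); have := set22 (tail d) (head d).
rewrite -!/(en d) E !inE => hd td; have := tail_neq_head d.
case/orP: hd => /eqP hd; case/orP: td => /eqP td; rewrite ?hd ?td ?eqxx // => _.
  have dE : d = rev_dart d' by apply: dart_inj; rewrite ?tail_rev ?head_rev.
  by rewrite dE oo od' in od.
exact: dart_inj.
Qed.

Lemma sum_outdeg o (R : {set V}) :
  \sum_(v in R) outdeg o v = #|[pred d | o d & tail d \in R]|.
Proof.
rewrite -sum1_card (partition_big (@tail V e) (mem R)) => [|d /andP[] //].
apply: eq_bigr => v vR; rewrite /outdeg -sum1_card; apply: eq_bigl => d.
by rewrite !inE; case: eqP => [->|]; rewrite ?vR ?andbT ?andbF.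
Qed.

Lemma orientation_exists : exists o, orientation o.
Proof.
exists (fun d => enum_rank (tail d) < enum_rank (head d)) => d.
rewrite tail_rev head_rev -leqNgt ltn_neqAle (inj_eq val_inj).
by rewrite (inj_eq enum_rank_inj) eq_sym tail_neq_head.
Qed.

Definition flip (o : dart e -> bool) d x := o x (+) ((x == d) || (x == rev_dart d)).

Lemma flip_orientation o d : orientation o -> orientation (flip o d).
Proof.
move=> oo x; rewrite /flip oo addNb; congr (~~ (_ (+) _)).
by rewrite orbC (inj_eq (inv_inj rev_dartK)) (can2_eq rev_dartK rev_dartK).
Qed.

Lemma outdeg_flip o d v : orientation o -> o d ->
  outdeg (flip o d) v + (v == tail d) = outdeg o v + (v == head d).
Proof.
move=> oo od.
have E g : outdeg g v = (g d && (tail d == v)) +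
    ((g (rev_dart d) && (tail (rev_dart d) == v)) +
    \sum_(x | (x != d) && (x != rev_dart d)) (g x && (tail x == v))).
  have -> : outdeg g v = \sum_x (g x && (tail x == v)).
    rewrite /outdeg -sum1_card big_mkcond; apply: eq_bigr => x _.
    by rewrite inE; case: ifP.
  by rewrite (bigD1 d) //= (bigD1 (rev_dart d)) ?rev_dart_neq.
rewrite !E oo od /flip oo od !eqxx orbT /= !tail_rev.
under eq_bigr => x /andP[/negbTE xd /negbTE xr] do rewrite xd xr addbF.
by rewrite ![v == _]eq_sym; lia.
Qed.

(** * Hakimi's theorem on orientations with bounded out-degrees *)

Section Hakimi.
Variable c : V -> nat.

(** The subtraction is truncated: only vertices above their bound contribute. *)
Definition excess o := \sum_v (outdeg o v - c v).

Definition orel (o : dart e -> bool) u v :=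
  [exists d, [&& o d, tail d == u & head d == v]].

(* Reversing the first dart of the path moves one unit of excess to its head;
   iterating pushes it along the path until it reaches a deficient vertex. *)
Lemma push_excess p o v : orientation o ->
  path (orel o) v p -> uniq (v :: p) -> c v < outdeg o v ->
  outdeg o (last v p) < c (last v p) ->
  exists2 o', orientation o' & excess o' < excess o.
Proof.
elim: p o v => [|w p IH] o v oo; first by move=> _ _ /=; lia.
move=> /= /andP[/existsP[d /and3P[od /eqP td /eqP hd]] vp].
move=> /andP[vwp up] cv cu.
have vw : w != v by rewrite -td -hd eq_sym tail_neq_head.
pose o1 := flip o d; have oo1 : orientation o1 by exact: flip_orientation.
have deg1 x := outdeg_flip x oo od; rewrite td hd -/o1 in deg1.
have degv := deg1 v; have degw := deg1 w.
rewrite eqxx [v == w]eq_sym (negbTE vw) in degv.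
rewrite eqxx (negbTE vw) in degw.
have E g : excess g = (outdeg g v - c v) + ((outdeg g w - c w) +
    \sum_(x | (x != v) && (x != w)) (outdeg g x - c x)).
  by rewrite /excess (bigD1 v) //= (bigD1 w).
have S : \sum_(x | (x != v) && (x != w)) (outdeg o1 x - c x)
       = \sum_(x | (x != v) && (x != w)) (outdeg o x - c x).
  apply: eq_bigr => x /andP[/negbTE xv /negbTE xw].
  by have := deg1 x; rewrite xv xw !addn0 => ->.
have [lw|gw] := ltnP (outdeg o w) (c w).
  by exists o1 => //; rewrite !E S; lia.
(* Here [w] is not deficient: the flip moves one unit of excess from [v] to [w], keeps the total,
   and the induction continues from [w]. *)
have uw : last w p != w by apply: contraTneq cu => ->; rewrite -leqNgt.
have uv : last w p != v by apply: contraTneq cu => ->; rewrite -leqNgt ltnW.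
have := deg1 (last w p); rewrite (negbTE uw) (negbTE uv) !addn0 => degu.
have [|||o' oo' lt] := IH o1 w oo1 _ up; rewrite ?degu //; first last.
- by exists o' => //; apply: leq_trans lt _; rewrite !E S; lia.
- by lia.
(* The flipped edge is incident to [v], which the rest of the path avoids, so that rest survives the
   flip. *)
apply: (@sub_in_path _ (predC1 v)) vp => [a b av bv|]; last first.
  by apply/allP => x xp; rewrite inE; apply: contraNneq vwp => <-.
move=> /existsP[x /and3P[ox /eqP ax /eqP bx]].
apply/existsP; exists x; rewrite ax bx !eqxx !andbT /o1 /flip ox.
have -> : (x == d) = false.
  by apply: contraNF av => /eqP xd; rewrite -ax xd td /= eqxx.
rewrite /=; apply: contra bv => /eqP xd.
by rewrite -bx xd head_rev td eqxx.
Qed.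

(** Induction on the excess. If an overfull [v] reaches no deficient vertex, the set [R] reachable
    from [v] is closed under out-darts, so it induces as many edges as its out-degree sum, which
    exceeds the sum of [c]. *)
Lemma hakimi_orientation :
  (forall R : {set V}, #|induced_edges e R| <= \sum_(v in R) c v) ->
  exists2 o, orientation o & forall v, outdeg o v <= c v.
Proof.
move=> sparse; have [o oo] := orientation_exists.
have [m] := ubnP (excess o); elim: m o oo => // m IH o oo lem.
have [/forallP le|] := boolP [forall v, outdeg o v <= c v]; first by exists o.
rewrite negb_forall => /existsP[v]; rewrite -ltnNge => cv.
have [/existsP[u /andP[vu cu]]|] :=
    boolP [exists u, connect (orel o) v u && (outdeg o u < c u)].
  have /connectP[p vp uE] := vu; rewrite uE in cu.
  case/shortenP: vp cu => q vq uq _ cu.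
  have [o' oo' lt] := push_excess oo vq uq cv cu.
  by apply: (IH o') => //; lia.
rewrite negb_exists => /forallP no.
pose R := [set u | connect (orel o) v u].
have := sparse R; rewrite -(card_oriented_darts R oo) leqNgt => /negP[].
suff -> : #|[pred d | [&& o d, tail d \in R & head d \in R]]|
    = \sum_(u in R) outdeg o u.
  have vR : v \in R by rewrite inE connect0.
  rewrite (bigD1 v) //= [in ltnRHS](bigD1 v) //= -addSn; apply: leq_add => //.
  apply: leq_sum => u /andP[uR _]; have := no u.
  by rewrite inE in uR; rewrite uR -leqNgt.
rewrite sum_outdeg; apply: eq_card => d; rewrite !inE.
case od : (o d) => //=; case td : (connect _ _ _) => //=.
apply: connect_trans td (connect1 _); apply/existsP.
by exists d; rewrite od !eqxx.
Qed.

End Hakimi.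
End Darts.

(** * Faces of the rotation system *)

Section Faces.
Variables (V : finType) (e : rel V) (sigma : {perm dart e}).
Hypothesis sg : simple_graph e.
Hypothesis rs : rotation_system sigma.
Hypothesis econ : forall u v : V, connect e u v.

Lemma face_succ_inj : injective (face_succ sigma).
Proof. by move=> d d' /perm_inj /(inv_inj (rev_dartK sg)). Qed.

(** A face is named by a representative dart, so sets of faces are sets of darts and [face f = f]
    selects representatives. *)
Definition face (d : dart e) := froot (face_succ sigma) d.

Lemma face_eq d d' : (face d == face d') = fconnect (face_succ sigma) d d'.
Proof. by rewrite /face root_connect //; exact: fconnect_sym face_succ_inj. Qed.

Lemma face_face d : face (face d) = face d.
Proof. by apply: root_root; exact: fconnect_sym face_succ_inj. Qed.

Lemma face_face_succ d : face (face_succ sigma d) = face d.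
Proof.
by apply/eqP; rewrite face_eq (fconnect_sym face_succ_inj) fconnect1.
Qed.

Lemma face_rev d : face (rev_dart d) = face (sigma d).
Proof. by rewrite -face_face_succ /face_succ (rev_dartK sg). Qed.

Lemma tail_face_succ d : tail (face_succ sigma d) = head d.
Proof. by have [ts _] := rs; rewrite /face_succ ts tail_rev. Qed.

(** * Components of the boundary graph of a set of faces *)

Section Component.
Variables (S : {set dart e}) (w0 : V).

Definition adjacent_to d := (face d \in S) || (face (rev_dart d) \in S).

Definition boundary_rel u v :=
  [exists d, [&& adjacent_to d, tail d == u & head d == v]].

Definition component := [set w | connect boundary_rel w0 w].

Definition component_faces :=
  [set f in S | (face f == f) && (tail f \in component)].

Lemma adjacent_to_rev d : adjacent_to (rev_dart d) = adjacent_to d.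
Proof. by rewrite /adjacent_to (rev_dartK sg) orbC. Qed.

Lemma boundary_rel_sym : connect_sym boundary_rel.
Proof.
apply: sym_connect_sym => u v.
by apply/existsP/existsP => -[d /and3P[ad td hd]]; exists (rev_dart d);
   rewrite adjacent_to_rev ad tail_rev // head_rev // td hd.
Qed.

Lemma component_ind (Y : pred V) :
  (forall d, adjacent_to d -> Y (tail d) -> tail d \in component -> Y (head d)) ->
  Y w0 -> {in component, forall w, Y w}.
Proof.
move=> Yd Y0 w; rewrite inE => cw.
suff : w \in [predI component & Y] by rewrite inE => /andP[].
have -> : (w \in [predI component & Y]) = (w0 \in [predI component & Y]).
  symmetry; apply: closed_connect cw; apply: intro_closed => [|u v uv].
    exact: boundary_rel_sym.
  have /existsP[d /and3P[ad /eqP td /eqP hd]] := uv.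
  rewrite !inE => /andP[cu Yu]; apply/andP; split.
    exact: connect_trans cu (connect1 uv).
  by rewrite unfold_in -hd; apply: Yd; rewrite ?td ?inE.
by rewrite !inE connect0.
Qed.

Lemma component_adjacent d : adjacent_to d ->
  (tail d \in component) = (head d \in component).
Proof.
move=> ad; rewrite !inE; apply: (same_connect_r boundary_rel_sym).
by apply: connect1; apply/existsP; exists d; rewrite ad !eqxx.
Qed.

(** The boundary walk of a face in [S] uses only boundary edges, so it stays in one component. *)
Lemma component_face d : face d \in S ->
  (tail (face d) \in component) = (tail d \in component).
Proof.
move=> fd; have := connect_root (frel (face_succ sigma)) d.
rewrite -/(face d) => /iter_findex <-.
set n := findex _ _ _; elim: n => //= n <-.
rewrite tail_face_succ -component_adjacent //.
suff E : face (iter n (face_succ sigma) d) = face d by rewrite /adjacent_to E fd.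
by apply/eqP; rewrite eq_sym face_eq fconnect_iter.
Qed.

Local Open Scope ring_scope.

(* Independence of the face boundaries in the cycle space: were the inequality
   false, some face potential [x] and vertex potential [p], not both zero, would
   have [x (face d) - x (face (rev_dart d)) = p (tail d) - p (head d)]; this is
   both a circulation and a potential difference, hence zero. *)
Lemma component_faces_card o : orientation o -> (exists d, face d \notin S) ->
  (#|component_faces| + #|component| <=
   #|[set d | [&& o d, adjacent_to d & tail d \in component]]| + 1)%N.
Proof.
move=> oo [d0 d0S]; rewrite leqNgt; apply/negP => lt.
have w0c : w0 \in component by rewrite inE connect0.
(* Unknowns: potentials of the faces and vertices of the component, with [w0] fixed at 0. Each
   oriented boundary edge gives one equation. *)
pose B : {set dart e + V} := [set z | match z with
  | inl f => f \in component_faces | inr w => (w \in component) && (w != w0) end].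
pose M d (z : dart e + V) : rat := match z with
  | inl f => (face d == f)%:R - (face (rev_dart d) == f)%:R
  | inr w => (head d == w)%:R - (tail d == w)%:R end.
have [|y [[z zB yz] yB ysol]] := @underdetermined_system _ _
    [set d | [&& o d, adjacent_to d & tail d \in component]] B M.
  have -> : #|B| = (#|component_faces| + #|component :\ w0|)%N.
    rewrite -!sum1_card big_mkcond big_sumType /= -!big_mkcond /=.
    congr (_ + _)%N; apply: eq_bigl => u; rewrite !inE //.
    by rewrite andbC.
  by have := cardsD1 w0 component; rewrite w0c; lia.
pose x f := y (inl f); pose p w := y (inr w).
pose g d := x (face d) - x (face (rev_dart d)).
have grev d : g (rev_dart d) = - g d by rewrite /g (rev_dartK sg) opprB.
have pick_sum (I : finType) (F : I -> rat) i :
    \sum_j (i == j)%:R * F j = F i.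
  rewrite (bigD1 i) //= eqxx mul1r big1 ?addr0 // => j ij.
  by rewrite eq_sym (negbTE ij) mul0r.
have gE d : adjacent_to d -> tail d \in component -> g d = p (tail d) - p (head d).
  have pos d' : o d' -> adjacent_to d' -> tail d' \in component ->
      g d' = p (tail d') - p (head d').
    move=> od ad td; have := ysol d'; rewrite inE od ad td => /(_ isT).
    rewrite big_sumType /=.
    under eq_bigr do rewrite mulrBl.
    under [in X in _ + X]eq_bigr do rewrite mulrBl.
    rewrite !sumrB !(pick_sum _ (fun f => y (inl f))).
    rewrite !(pick_sum _ (fun f => y (inr f))) /g /x /p => E.
    by apply/eqP; rewrite -subr_eq0 opprB; apply/eqP.
  move=> ad td; have [/pos -> //|nod] := boolP (o d).
  apply: oppr_inj; rewrite -grev opprB pos ?oo ?adjacent_to_rev //.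
    by rewrite tail_rev // head_rev.
  by rewrite tail_rev // -component_adjacent.
have x0 f : f \notin component_faces -> x f = 0.
  by move=> fT; apply: yB; rewrite inE.
have g0 d : ~~ (adjacent_to d && (tail d \in component)) -> g d = 0.
  move=> H; rewrite /g !x0 ?subrr //; apply: contra H; rewrite inE => /and3P[fS _].
    rewrite component_face // /adjacent_to fS orbT tail_rev // => hc.
    by rewrite component_adjacent // /adjacent_to fS orbT.
  by rewrite component_face // /adjacent_to fS.
(* Since [face (rev_dart d)] is [face (sigma d)], the differences cancel around each vertex: [g] is
   a circulation. *)
have circ : \sum_d g d * p (tail d) = 0.
  under eq_bigr do rewrite /g mulrBl.
  rewrite sumrB; apply/eqP; rewrite subr_eq0; apply/eqP.
  rewrite (reindex_inj (@perm_inj _ sigma)); apply: eq_bigr => d _.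
  by rewrite face_rev; have [-> _] := rs.
have circ' : \sum_d g d * p (head d) = 0.
  rewrite (reindex_inj (inv_inj (rev_dartK sg))).
  under eq_bigr do rewrite grev head_rev // mulNr.
  by rewrite sumrN circ oppr0.
(* The sum of the squares of [g] pairs a circulation with a potential difference, hence is 0. *)
have gz d : g d = 0.
  have /eqP : \sum_d g d ^+ 2 = 0.
    transitivity (\sum_d g d * p (tail d) - \sum_d g d * p (head d));
      last by rewrite circ circ' subrr.
    rewrite -sumrB; apply: eq_bigr => d' _.
    rewrite expr2 -mulrBr; have [/andP[ad td]|/g0 ->] :=
      boolP (adjacent_to d' && (tail d' \in component)); last by rewrite !mul0r.
    by rewrite -gE.
  rewrite psumr_eq0 => [/allP/(_ d)|d' _]; last exact: sqr_ge0.
  by rewrite mem_index_enum sqrf_eq0 => /(_ isT)/eqP.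
(* Potentials agree across every edge, so by connectedness [x] is constant on faces; it vanishes at
   the face of [d0], outside [S]. *)
have xface d : x (face d) = 0.
  pose Y := [pred u | [forall d, (tail d == u) ==> (x (face d) == 0)]].
  have xrev d' : x (face (rev_dart d')) = x (face d').
    by apply/esym/eqP; rewrite -subr_eq0; apply/eqP/gz.
  have xtail d1 d2 : tail d1 = tail d2 -> x (face d1) = x (face d2).
    have [_ cs] := rs; move=> /cs/iter_findex <-.
    by elim: (findex _ _ _) => //= n ->; rewrite -face_rev xrev.
  suff : tail d \in Y by move=> /forallP/(_ d); rewrite eqxx => /eqP.
  have <- : (tail d0 \in Y) = (tail d \in Y).
    apply: (closed_connect _ (econ _ _)); apply: intro_closed.
      by apply: sym_connect_sym; case: sg.
    move=> u v /(dartP (e := e))[d1 [<- <-]] /forallP/(_ d1).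
    rewrite eqxx /= => /eqP E.
    apply/forallP => d2; apply/implyP => /eqP d2E; rewrite (xtail _ (rev_dart d1)).
      by rewrite xrev E.
    by rewrite tail_rev.
  apply/forallP => d1; apply/implyP => /eqP /xtail ->; rewrite x0 //.
  by rewrite inE (negbTE d0S).
have pc : {in component, forall w, p w = 0}.
  move=> w wc; apply/eqP; apply: (component_ind (Y := fun w => p w == 0)) wc.
    move=> d ad pd td; have := gE d ad td; rewrite gz (eqP pd) sub0r => /eqP.
    by rewrite eq_sym oppr_eq0.
  by rewrite /p yB // inE eqxx andbF.
case: z zB yz => [f|w]; rewrite inE.
  rewrite inE => /and3P[_ /eqP ff _]; rewrite -[y _]/(x f) -ff xface.
  by rewrite eqxx.
by case/andP=> wc _; rewrite -[y _]/(p w) pc // eqxx.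
Qed.

End Component.

(** * Choice of the bits at the vertices *)

Section Bits.
Variables (s0 s1 : V).
Hypothesis es : e s0 s1.
Hypothesis lam_e : laman e.

Definition avoids (S : {set dart e}) :=
  forall d, [set tail d; head d] = [set s0; s1] -> face d \notin S.

Lemma s0_neq_s1 : s0 != s1.
Proof. by have [_ ir] := sg; apply: contraTneq es => ->; rewrite ir. Qed.

(** Here [t] counts faces, [w] vertices, [m] boundary edges, [i] induced edges and [w2] non-special
    vertices; [b0] and [b1] tell whether [s0] and [s1] occur. The bounds give [t <= w - 2], and
    [t <= w - 3] if both occur. *)
Lemma component_faces_lt_arith t w m i w1 w2 (b0 b1 : bool) :
  t + w <= m + 1 -> i + 3 <= 2 * w -> m + (b0 && b1) <= i ->
  w = b0 + w1 -> w1 = b1 + w2 -> t < w2.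
Proof. by clear; case: b0; case: b1; lia. Qed.

Lemma component_faces_lt (S : {set dart e}) f : avoids S -> face f \in S ->
  #|component_faces S (tail f)| < #|component S (tail f) :\: [set s0; s1]|.
Proof.
move=> av fS; set W := component _ _.
have [o oo] := orientation_exists sg.
have [d1 [td1 hd1]] := dartP es.
have d1S : face d1 \notin S by apply: av; rewrite td1 hd1.
have rd1S : face (rev_dart d1) \notin S.
  by apply: av; rewrite tail_rev // head_rev // td1 hd1 setUC.
have := component_faces_card (tail f) oo (ex_intro (fun d => face d \notin S) _ d1S).
rewrite -/W; set E := [set d | _] => H.
have [d2 od2 E2] : exists2 d2, o d2 & d2 = d1 \/ d2 = rev_dart d1.
  have [od|nod] := boolP (o d1); first by exists d1; [|left].
  by exists (rev_dart d1); [rewrite oo|right].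
have [_ spW] := lam_e.
have tW : tail f \in W by rewrite inE connect0.
have adf : adjacent_to S f by rewrite /adjacent_to fS.
have hW : head f \in W by rewrite -component_adjacent.
have W2 : 2 <= #|W|.
  apply: leq_trans (subset_leq_card (_ : [set tail f; head f] \subset W)).
    by rewrite cards2 (tail_neq_head sg).
  by rewrite subUset !sub1set tW hW.
have := spW W W2; rewrite -(card_oriented_darts sg W oo).
set I := [pred d | _] => HI.
(* If both special vertices occur, the edge between them is induced by [W] but bounds no face of
   [S]. *)
have EI : #|E| + ((s0 \in W) && (s1 \in W)) <= #|I|.
  case: andP => [[W0 W1]|_]; last first.
    rewrite addn0; apply: subset_leq_card; apply/subsetP => d.
    rewrite !inE => /and3P[-> ad td].
    by have := component_adjacent (tail f) ad; rewrite !inE td => <-.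
  have d2E : d2 \notin E.
    rewrite inE od2 /= negb_and /adjacent_to.
    by case: E2 => ->; rewrite ?(rev_dartK sg) (negbTE d1S) (negbTE rd1S).
  rewrite addn1 -add1n -[1 + _]/(true + _) -d2E -cardsU1.
  apply: subset_leq_card; apply/subsetP => d; rewrite in_setU1 => /orP[/eqP ->|].
    rewrite inE od2.
    by case: E2 => ->; rewrite ?tail_rev ?head_rev // td1 hd1 W0 W1.
  rewrite !inE => /and3P[-> ad td].
  by have := component_adjacent (tail f) ad; rewrite !inE td => <-.
apply: (component_faces_lt_arith H HI EI (cardsD1 s0 W)).
have := cardsD1 s1 (W :\ s0).
by rewrite setDDl in_setD1 eq_sym s0_neq_s1.
Qed.

Lemma component_on_face (S : {set dart e}) f v : face f \in S ->
  v \in component S (tail f) -> exists2 d, face d \in S & tail d = v.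
Proof.
move=> fS vW.
suff /exists_inP[d dS /eqP dv] : [exists (d | face d \in S), tail d == v].
  by exists d.
apply: (component_ind (Y := fun v => [exists (d | face d \in S), tail d == v])) vW.
  move=> d /orP[dS|dS] _ _; apply/exists_inP.
    by exists (face_succ sigma d); rewrite ?face_face_succ ?tail_face_succ.
  by exists (rev_dart d); rewrite ?tail_rev.
by apply/exists_inP; exists f.
Qed.

(* Seymour's linear algebra method for 2-colouring set systems with more points
   than sets: colour the support of a kernel vector by sign, and recurse on the
   faces that miss the support. *)
Lemma no_constant_face (r : dart e -> bool) (S : {set dart e}) : avoids S ->
  exists b : V -> bool, [/\ b s0 = false, b s1 = true &
    forall f, f \in S -> face f = f -> exists d d', [/\ face d = f, face d' = f &
      r d (+) b (tail d) != r d' (+) b (tail d')]].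
Proof.
have [m] := ubnP #|S|; elim: m S => // m IH S ltm avS.
have [/exists_inP[f0 f0S /eqP f00]|] :=
  boolP [exists (f | f \in S), face f == f]; last first.
  rewrite negb_exists_in => /forall_inP no.
  exists (fun v => v == s1); rewrite eqxx (negbTE s0_neq_s1); split=> // f fS /eqP.
  by rewrite (negbTE (no f fS)).
pose W := component S (tail f0).
have ff0S : face f0 \in S by rewrite f00.
pose M f v : rat := (\sum_(d | face d == f) (-1) ^+ r d *+ (tail d == v))%R.
have [y [[v vB yv] yB ysol]] :=
  underdetermined_system M (component_faces_lt avS ff0S).
(* Faces missing the support of [y]. The face of [d1] is in [S] but meets the support, so the
   recursion is on a smaller set. *)
pose S2 := [set f in S | [forall (d | face d == f), y (tail d) == 0%R]].
have [d1 d1S d1v] : exists2 d, face d \in S & tail d = v.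
  by apply: component_on_face ff0S _; move: vB; rewrite in_setD => /andP[].
have ltS2 : #|S2| < #|S|.
  apply/proper_card/properP; split.
    by apply/subsetP => f; rewrite inE => /andP[].
  exists (face d1) => //; rewrite in_set d1S andTb; apply/forall_inPn.
  by exists d1; [rewrite unfold_in !eqxx | rewrite d1v].
have avS2 : avoids S2.
  by move=> d /avS; apply: contra; rewrite inE => /andP[].
have [b [b0 b1 bS]] := IH S2 (leq_trans ltS2 ltm) avS2.
have ys s : s \in [set s0; s1] -> y s = 0%R.
  by move=> ss; apply: yB; rewrite in_setD ss.
(* Since [y] vanishes at [s0] and [s1], these keep their prescribed bits. *)
exists (fun v => if y v == 0%R then b v else (0 < y v)%R).
rewrite !ys ?set21 ?set22 ?eqxx //; split=> // f fS ff.
have [/forall_inP fy|/forall_inPn[d2 d2f yd2]] :=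
  boolP [forall (d | face d == f), y (tail d) == 0%R].
  have [|//|d [d' [df d'f dd']]] := bS f; first by rewrite inE fS; apply/forall_inP.
  by exists d, d'; rewrite df d'f !fy ?df ?d'f.
rewrite unfold_in in d2f.
have d2W : tail d2 \in W.
  have : tail d2 \in W :\: [set s0; s1] by apply: contraNT yd2 => /yB ->.
  by rewrite in_setD => /andP[].
(* A face meeting the support lies in the component, so its equation is in the system. *)
have fT : f \in component_faces S (tail f0).
  by rewrite inE fS ff eqxx /= -(eqP d2f) component_face // (eqP d2f).
have : (\sum_(d | face d == f) (-1) ^+ r d * y (tail d) = 0)%R.
  rewrite -[RHS](ysol f fT); under [RHS]eq_bigr do rewrite /M mulr_suml.
  rewrite exchange_big /=; apply: eq_bigr => d _.
  rewrite (bigD1 (tail d)) //= eqxx big1 ?addr0 // => u ud.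
  by rewrite eq_sym (negbTE ud) mul0r.
move=> /(sum0_opposite_signs (P := fun d => face d == f) d2f).
move=> [|[d /eqP df dp] [d' /eqP d'f d'n]].
  by rewrite mulf_neq0 // signr_eq0.
(* On the support, the label of an angle is 1 exactly when its signed term is positive. *)
have sgnE d3 : ((-1) ^+ r d3 * y (tail d3) != 0 -> r d3 (+) (if y (tail d3) == 0
     then b (tail d3) else 0 < y (tail d3)) = (0 < (-1) ^+ r d3 * y (tail d3)))%R.
  rewrite mulf_eq0 negb_or signr_eq0 /= => /negbTE z; rewrite z.
  case: (r d3) => /=; rewrite ?expr1 ?expr0 ?mul1r ?mulN1r ?oppr_gt0 //.
  by rewrite -leNgt le_eqVlt z.
exists d, d'; split=> //; rewrite !sgnE ?dp ?(gt_eqF dp) ?(lt_eqF d'n) //.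
by rewrite lt_gtF.
Qed.

End Bits.

End Faces.

(** * Orientation of a Laman graph *)

Section Laman.
Variables (V : finType) (e : rel V).
Hypothesis sg : simple_graph e.
Hypothesis lam_e : laman e.

Lemma laman_edge : exists s0 s1, e s0 s1.
Proof.
have [cE _] := lam_e; have : 0 < #|edges e| by lia.
by case/card_gt0P => x /imsetP[[u v]]; rewrite inE /= => uv _; exists u, v.
Qed.

Lemma edgesE : edges e = induced_edges e setT.
Proof.
by apply/setP => x; apply/imsetP/imsetP => -[p]; rewrite !inE => pe ->;
   exists p; rewrite ?inE.
Qed.

(** The bounds 0, 1, 2 sum to at least [2 * #|R| - 3] on [R], so the Laman count gives Hakimi's
    condition. Over all vertices they sum to the number of edges, so every bound is attained. *)
Lemma laman_orientation s0 s1 : e s0 s1 ->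
  exists2 o : dart e -> bool, orientation o &
    forall v, outdeg o v = if v == s1 then 0 else if v == s0 then 1 else 2.
Proof.
move=> es; have s01 := s0_neq_s1 sg es; have [cE spE] := lam_e.
pose c v := if v == s1 then 0 else if v == s0 then 1 else 2.
have cR (R : {set V}) : \sum_(v in R) c v + (2 * (s1 \in R) + (s0 \in R)) = 2 * #|R|.
  have ind s : \sum_(v in R) (v == s) = (s \in R).
    by rewrite -big_mkcondr /= sum1dep_card; case sR : (s \in R);
      [rewrite (@eq_card1 _ s) // => v | rewrite eq_card0 // => v];
      rewrite !inE; case: eqP => [->|]; rewrite ?sR ?andbF.
  rewrite -!ind big_distrr -!big_split /= [RHS]mulnC -sum_nat_const.
  apply: eq_bigr => v _; rewrite /c.
  case: (v =P s1) => [->|_]; first by rewrite eq_sym (negbTE s01).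
  by case: eqP.
have [|o oo le] := @hakimi_orientation _ _ sg c.
  move=> R; have := cR R; have [R2|R1] := leqP 2 #|R|.
    by have := spE R R2; case: (s0 \in R); case: (s1 \in R); lia.
  move=> _; have [o oo] := orientation_exists sg.
  rewrite -(card_oriented_darts sg R oo).
  rewrite eq_card0 // => d; rewrite !inE; apply: contraTF R1.
  case/and3P=> _ td hd; rewrite -leqNgt.
  apply: leq_trans (subset_leq_card (_ : [set tail d; head d] \subset R)).
    by rewrite cards2 (tail_neq_head sg).
  by rewrite subUset !sub1set td hd.
exists o => // v.
have := leqif_sum (fun v (_ : v \in [set: V]) => leqif_eq (le v)).
case=> _; rewrite (sum_outdeg o [set: V]).
have := cR [set: V]; rewrite !in_setT cardsT => cT.
have := card_oriented_darts sg [set: V] oo; rewrite -edgesE.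
rewrite (@eq_card _ _ [pred d | o d & tail d \in [set: V]]) => [cO|d]; last first.
  by rewrite !inE.
move=> /esym; rewrite cO (_ : _ == _ = true); last by apply/eqP; lia.
by move=> /forall_inP/(_ v (in_setT v))/eqP.
Qed.

End Laman.

(** * Construction and verification of the labeling *)

Theorem theorem38 (V : finType) (e : rel V) (sigma : {perm dart e}) :
  simple_graph e -> laman e -> plane_embedding sigma ->
  exists (s0 s1 : V) (lam : dart e -> bool), ext_weak_labeling sigma s0 s1 lam.
Proof.
move=> sg lam_e [rs [econ euler]].
have [s0 [s1 es]] := laman_edge lam_e; have s01 := s0_neq_s1 sg es.
have [o oo odeg] := laman_orientation sg lam_e es.
have [d1 [td1 hd1]] := dartP es.
have o1 d : o d -> tail d != s1.
  move=> od; apply/eqP => td; have := odeg s1; rewrite eqxx.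
  by move/eqP; rewrite -leqn0 leqNgt => /card_gt0P[]; exists d; rewrite inE od td /=.
have od1 : o d1.
  have := o1 (rev_dart d1); rewrite oo tail_rev // hd1 eqxx.
  by case: (o d1) => // /(_ isT).
have o0 d : o d -> tail d = s0 -> d = d1.
  move=> od td; have := odeg s0; rewrite (negbTE s01) eqxx => /eq_leq/card_le1_eqP.
  by apply; rewrite inE ?od ?td ?od1 ?td1 eqxx.
have special d : [set tail d; head d] = [set s0; s1] -> o d -> d = d1.
  move=> dE od; apply: o0 => //; have := set21 (tail d) (head d).
  by rewrite dE !inE (negbTE (o1 d od)) orbF => /eqP.
(* The dart from [s0] to [s1] is dropped, so labels never change around [s0]. *)
pose out d := o d && (tail d != s0).
have out_sum d : [set tail d; head d] != [set s0; s1] -> out d (+) out (rev_dart d).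
  have pos d' : [set tail d'; head d'] != [set s0; s1] -> o d' ->
      out d' && ~~ out (rev_dart d').
    move=> nd od; rewrite /out oo od /= andbT; apply: contraNneq nd => td.
    by rewrite (o0 d' od td) td1 hd1.
  move=> nd; have [od|nod] := boolP (o d).
    by have /andP[-> /negbTE ->] := pos d nd od.
  have := pos (rev_dart d); rewrite oo tail_rev // head_rev // setUC => /(_ nd nod).
  by rewrite (rev_dartK sg) => /andP[-> /negbTE ->].
have [tsigma csigma] := rs.
have fcon d x : fconnect sigma d x = (tail x == tail d).
  apply/idP/eqP => [/iter_findex <-|/esym/csigma //].
  by elim: (findex _ _ _) => //= n <-; rewrite tsigma.
have out_card d : #|[pred x | fconnect sigma d x & out x]|
    = if (tail d == s0) || (tail d == s1) then 0 else 2.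
  case: ifPn => [ts|].
    apply: eq_card0 => x; rewrite !inE fcon; apply/negP => /and3P[/eqP tx ox xs0].
    by move: ts; rewrite -tx (negbTE xs0) (negbTE (o1 x ox)).
  rewrite negb_or => /andP[/negbTE t0 /negbTE t1].
  have := odeg (tail d); rewrite t0 t1 => <-; apply: eq_card => x.
  rewrite !inE fcon /out; case: eqP => [->|]; rewrite ?andbF //.
  by rewrite t0 andbT.
have [|r [rsigma r0]] := cyclic_primitive (@perm_inj _ sigma) (D := out).
  by move=> d; rewrite out_card; case: ifP.
(* Faces at the edge [s0 s1] are left out of [S]: they see both labels at its two ends. *)
pose onspecial f := [exists d : dart e,
  ([set tail d; head d] == [set s0; s1]) && (face sigma d == f)].
pose S := [set f | (face sigma f == f) && ~~ onspecial f].
have avS : avoids sigma s0 s1 S.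
  move=> d dE; rewrite inE negb_and negbK; apply/orP; right.
  by apply/existsP; exists d; rewrite dE !eqxx.
have [b [b0 b1 bS]] := no_constant_face sg rs econ es lam_e r avS.
pose lam d := r d (+) b (tail d).
have lamsigma d : lam (sigma d) = lam d (+) out d.
  by rewrite /lam rsigma tsigma addbAC.
have no_out d x : (tail d == s0) || (tail d == s1) -> fconnect sigma d x -> ~~ out x.
  rewrite fcon => ts /eqP tx; rewrite /out negb_and negbK.
  case/orP: ts => /eqP ts; first by rewrite tx ts eqxx orbT.
  by rewrite (contraTN (o1 x)) // tx ts.
have lam0 d : tail d = s0 -> lam d = false.
  by move=> td; rewrite /lam td b0 r0 // => x; apply: no_out; rewrite td eqxx.
have lam1 d : tail d = s1 -> lam d = true.
  by move=> td; rewrite /lam td b1 r0 // => x; apply: no_out; rewrite td eqxx orbT.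
have lam_special d d' : [set tail d; head d] = [set s0; s1] -> tail d' = head d ->
    lam d != lam d'.
  move=> dE td'; have := tail_neq_head sg d.
  have := set21 (tail d) (head d); have := set22 (tail d) (head d).
  rewrite dE !inE => /orP[] /eqP hd /orP[] /eqP td; rewrite hd td ?eqxx // => _.
    by rewrite (lam1 d) // (lam0 d') ?td'.
  by rewrite (lam0 d) // (lam1 d') ?td'.
pose phi := face_succ sigma.
have injphi : injective phi := face_succ_inj sg.
(* The angles [x] and [phi x] are consecutive in their face, at the two ends of the edge of [x]. *)
pose chg x := lam x != lam (phi x).
have chgE x : chg x = lam x (+) lam (rev_dart x) (+) out (rev_dart x).
  by rewrite /chg /phi /face_succ lamsigma negb_eqb addbA.
have nonconst f : exists d d',
    [/\ fconnect phi f d, fconnect phi f d' & lam d != lam d'].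
  have : face sigma (face sigma f) = face sigma f by exact: face_face.
  have [/existsP[d /andP[/eqP dE /eqP df]] _|nsp ff] :=
    boolP (onspecial (face sigma f)).
    exists d, (phi d); split.
    - by rewrite -face_eq // df.
    - by rewrite -same_fconnect1_r // -face_eq // df.
    - by apply: lam_special; rewrite // tail_face_succ.
  have [|//|d [d' [df d'f dd']]] := bS (face sigma f); first by rewrite inE ff eqxx.
  by exists d, d'; rewrite -!face_eq // df d'f.
have chg_pair x : o x -> chg x + chg (rev_dart x) = 1 + (x == d1).
  move=> ox; case: eqP => [->|xd1].
    rewrite /chg !lam_special ?tail_face_succ ?tail_rev ?head_rev ?td1 ?hd1 //.
    by rewrite setUC.
  have /out_sum : [set tail x; head x] != [set s0; s1].
    by apply: contra_notN xd1 => /eqP xE; apply: special.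
  rewrite !chgE (rev_dartK sg) [lam (rev_dart x) (+) _]addbC.
  by case: (lam x (+) _); case: (out x); case: (out _).
have total : #|[pred x | chg x]| = #|edges e| + 1.
  transitivity (\sum_x chg x).
    rewrite -sum1_card big_mkcond; apply: eq_bigr => x _.
    by rewrite inE; case: (chg x).
  rewrite (bigID o) /= [X in _ + X](reindex_inj (inv_inj (rev_dartK sg))) /=.
  under [X in _ + X]eq_bigl do rewrite oo negbK.
  rewrite -big_split /= (eq_bigr _ chg_pair) big_split /= sum1dep_card.
  congr (_ + _).
    rewrite edgesE -(card_oriented_darts sg setT oo).
    by apply: eq_card => x; rewrite !inE !andbT.
  by rewrite (bigD1 d1) //= eqxx big1 // => x /andP[_ /negbTE ->].
pose cnt f := #|[pred x | fconnect phi f x & chg x]|.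
have cnt2 f : 2 <= cnt f.
  have [d [d' [fd fd' dd']]] := nonconst f.
  by have [] := orbit_changes injphi fd fd' dd'.
(* Euler's formula and the edge count make the total twice the number of faces, so the lower bound 2
   is attained at each face. *)
have cntE f : face sigma f == f -> cnt f = 2.
  have sumcnt : \sum_(f | face sigma f == f) cnt f = #|[pred x | chg x]|.
    rewrite -[RHS]sum1_card
      [RHS](partition_big (face sigma) (fun f => face sigma f == f)).
      apply: eq_bigr => f' /eqP ff; rewrite /cnt -sum1_card; apply: eq_bigl => x.
      by rewrite !inE andbC -face_eq // ff eq_sym.
    by move=> x _; rewrite face_face.
  have sum2 : \sum_(f | face sigma f == f) 2 = #|[pred x | chg x]|.
    rewrite sum_nat_const total; have [cE _] := lam_e.
    have -> : #|[pred f | face sigma f == f]| = fcard phi (@predT (dart e)).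
      by apply: eq_card => x; rewrite !inE andbT.
    by move: euler; rewrite -/phi; lia.
  have [_] := leqif_sum (fun f (_ : face sigma f == f) => leqif_eq (cnt2 f)).
  by rewrite sum2 sumcnt eqxx => /esym/forall_inP H /H /eqP <-.
exists s0, s1, lam; split; first by split=> // d; split; [exact: lam0 | exact: lam1].
split; last split.
- move=> d /eqP t0 /eqP t1.
  have cd := out_card d; rewrite (negbTE t0) (negbTE t1) /= in cd.
  have [x] : exists x, x \in [pred x | fconnect sigma d x & out x].
    by apply/card_gt0P; rewrite cd.
  rewrite !inE => /andP[dx ox].
  have chgs y : (lam y != lam (sigma y)) = out y.
    by rewrite lamsigma; case: (lam y); case: (out y).
  have dsx : fconnect sigma d (sigma x) by rewrite fcon tsigma -fcon.
  have [|_] := orbit_changes (lam := lam) (@perm_inj _ sigma) dx dsx.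
    by rewrite chgs.
  apply; rewrite (eq_card (B := [pred x | fconnect sigma d x & out x])) ?cd //.
  by move=> y; rewrite !inE chgs.
- move=> d /out_sum; rewrite !lamsigma.
  by case: (lam d); case: (lam (rev_dart d)); case: (out d); case: (out _).
move=> d; have [x [y [dx dy xy]]] := nonconst d.
have [_] := orbit_changes injphi dx dy xy; apply.
have <- : cnt (face sigma d) = 2 by apply: cntE; rewrite face_face.
rewrite leq_eqVlt; apply/orP; left; apply/eqP; apply: eq_card => z.
by rewrite !inE -!face_eq // face_face.
Qed.
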